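(* Let $A$ be a real $m\times n$ matrix with columns $A_1,\dots,A_n$, $b\in\mathbb{R}^m$, $c\in\mathbb{R}^n$, with $b$, $c$ and all $A_j$ of unit Euclidean norm, and let $P\equiv\min\{c^\top x\mid Ax=b,\ x\in\mathbb{R}^n_+\}$ have bounded non-empty feasible region, with a given $\theta\ge1$ such that some optimal solution $x^*$ of $P$ satisfies $\sum_jx^*_j<\theta$. Assume that $P$ satisfies the following two assumptions: (a) there is no degenerate vertex in the dual polyhedron $\mathcal{F}(D)=\{y\in\mathbb{R}^m\mid y^\top A\le c^\top\}$; (b) the vector $b$ belongs to the relative interior of the normal cone at some vertex of the dual polyhedron. Let $y^*$ be the (unique) optimal solution of $D\equiv\max\{b^\top y\mid y^\top A\le c^\top,\ y\in\mathbb{R}^m\}$, let $\mathcal{B}^*$ be the optimal basis, let $$d^*=\min_{j\notin\mathcal{B}^*}\frac{c_j-A_j^\top y^*}{\|A_j\|_2},$$ and let $\alpha^*$ and the universal constant $\mathcal{C}$ be as in the context. Let $T$ be a $k\times m$ random projector. If $\varepsilon>0$ satisfies $$\frac{\mathcal{C}\theta^2\varepsilon}{\cos(\alpha^* )\|b\|_2}\|y^*\|_2<\frac{d^*}{2},$$ then, with probability at least $1-4n\,e^{-\mathcal{C}(\varepsilon^2-\varepsilon^3)k}$, the retrieval algorithm described in the context returns an optimal basis solution.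
   Context: Retrieval algorithm. Let $P_T\equiv\min\{c^\top x\mid TAx=Tb,\ x\in\mathbb{R}^n_+\}$ be the projected problem, with dual $D_T\equiv\max\{(Tb)^\top y\mid y^\top TA\le c^\top,\ y\in\mathbb{R}^k\}$. Given an optimal basis of $P_T$, let $y_T$ be the associated basic (optimal) dual solution of $D_T$, and put $y_{\mathrm{prox}}=T^\top y_T$. For all $1\le j\le n$ compute $z_j=\frac{c_j-A_j^\top y_{\mathrm{prox}}}{\|A_j\|_2}$. Let $\mathcal{B}$ be the set of indices $j$ corresponding to the $m$ smallest values of $z_j$. Return $x=A_{\mathcal{B}}^{-1}b$, where $A_{\mathcal{B}}$ is the submatrix of $A$ formed by the columns indexed by $\mathcal{B}$. The normal cone of $\mathcal{F}(D)$ at a vertex $\bar y$ is $\{g\mid g^\top(y-\bar y)\le0\ \forall y\in\mathcal{F}(D)\}$; under (b) the dual solution $y^*$ is uniquely determined. A vertex of $\mathcal{F}(D)$ is non-degenerate if exactly $m$ of the constraints $A_j^\top y\le c_j$ are active at it; the optimal basis $\mathcal{B}^*$ is the set of indices of the constraints active at $y^*$. Definition of $\alpha^*$. Let $v^i=y^i-y^*$ for $1\le i\le q$, where $y^1,\dots,y^q$ are the neighbouring vertices of $y^*$ in $\mathcal{F}(D)$. The tangent cone of $\mathcal{F}(D)$ at $y^*$ (the closure of the set of feasible directions $\{d\mid\exists\lambda>0,\ y^*+\lambda d\in\mathcal{F}(D)\}$) is taken to be generated by these $v^i$, and $b^\top v^i<0$ for all $i$. Let $\alpha_i$ be the angle between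 $-b$ and $v^i$; $\alpha^*$ is one of $\alpha_1,\dots,\alpha_q$ with smallest cosine, i.e. $\cos(\alpha^* )=\min_i\cos(\alpha_i)$. Constant $\mathcal{C}$. It is the universal constant of the following lemma: for any $\varepsilon>0$ there is a constant $\mathcal{C}$ such that $\|y^*-y_{\mathrm{prox}}\|_2\le\frac{\mathcal{C}\theta^2\varepsilon}{\cos(\alpha^* )\|b\|_2}\|y^*\|_2$ with probability at least $1-4n\,e^{-\mathcal{C}(\varepsilon^2-\varepsilon^3)k}$. The same symbol $\mathcal{C}$ is used in the hypothesis and in the probability. A $k\times m$ random projector is a random $k\times m$ real matrix $T$ of one of four types: (1) $\sqrt{m/k}$ times the orthogonal projection of $\mathbb{R}^m$ onto a random $k$-dimensional linear subspace, written as a $k\times m$ matrix using an orthonormal basis of the subspace; (2) $\frac{1}{\sqrt{k}}U$ with $U$ having independent standard normal entries; (3) $\frac{1}{\sqrt{k}}U$ with $U$ having independent entries $\pm1$ with probability $\frac12$ each; (4) $\sqrt{3/k}\,U$ with $U$ having independent entries $+1,0,-1$ with probabilities $\frac16,\frac23,\frac16$. *)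

(* Defs.v *)
From HB Require Import structures.
From mathcomp Require Export all_boot all_order all_algebra.
From mathcomp Require Export all_classical all_reals all_analysis.

Set Implicit Arguments.
Unset Strict Implicit.
Unset Printing Implicit Defensive.

Import Order.TTheory GRing.Theory Num.Theory.
Export numFieldNormedType.Exports.

Local Open Scope classical_set_scope.
Local Open Scope ring_scope.

Definition is_minimum (R : realType) (S : set R) (x : R) : Prop :=
  S x /\ lbound S x.

Section Geometry.
Context {R : realType} {m : nat}.
Implicit Types (u v x y g : 'cV[R]_m) (S F : set 'cV[R]_m).

Definition dot u v : R := \sum_i u i 0 * v i 0.

(* Euclidean norm; the library norm `|u| of a matrix is the sup norm. *)
Definition norm2 u : R := Num.sqrt (dot u u).

Definition angle u v : R := acos (dot u v / (norm2 u * norm2 v)).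

Definition affine_hull S : set 'cV[R]_m :=
  [set x | exists (p : nat) (a : 'I_p -> R) (s : 'I_p -> 'cV[R]_m),
     [/\ forall i, S (s i), \sum_i a i = 1 & x = \sum_i a i *: s i]].

Definition relative_interior S : set 'cV[R]_m :=
  [set x | S x /\ \forall z \near x, affine_hull S z -> S z].

Definition conic_hull S : set 'cV[R]_m :=
  [set x | exists (p : nat) (a : 'I_p -> R) (s : 'I_p -> 'cV[R]_m),
     [/\ forall i, S (s i), forall i, 0 <= a i & x = \sum_i a i *: s i]].

(* For convex S, this says that S is a face of F. *)
Definition extreme_set F S : Prop :=
  S `<=` F /\
  forall x y (t : R), F x -> F y -> 0 < t < 1 ->
    S (t *: x + (1 - t) *: y) -> S x /\ S y.

Definition vertex F v : Prop := extreme_set F [set v].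

Definition segment_between u v : set 'cV[R]_m :=
  [set t *: u + (1 - t) *: v | t in `[0, 1]].

(* Two distinct vertices are neighbours when the segment joining them is an
   edge, i.e. a face. *)
Definition neighbour F u v : Prop :=
  [/\ vertex F u, vertex F v, u != v & extreme_set F (segment_between u v)].

Definition normal_cone F y : set 'cV[R]_m :=
  [set g | forall y', F y' -> dot g (y' - y) <= 0].

Definition tangent_cone F y : set 'cV[R]_m :=
  closure [set d | exists2 lambda : R, 0 < lambda & F (y + lambda *: d)].

Definition edge_directions F y : set 'cV[R]_m :=
  [set y' - y | y' in neighbour F y].

End Geometry.

(* The pair min {c^T x | A x = b, x >= 0} and max {b^T y | y^T A <= c^T}. *)
Section LinearProgram.
Context {R : realType} {m n : nat}.
Variables (A : 'M[R]_(m, n)) (b : 'cV[R]_m) (c : 'cV[R]_n).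

Definition primal_feasible : set 'cV[R]_n :=
  [set x | A *m x = b /\ forall j, 0 <= x j 0].

Definition primal_optimal (x : 'cV[R]_n) : Prop :=
  primal_feasible x /\ forall x', primal_feasible x' -> dot c x <= dot c x'.

Definition dual_feasible : set 'cV[R]_m :=
  [set y | forall j, dot (col j A) y <= c j 0].

Definition dual_optimal (y : 'cV[R]_m) : Prop :=
  dual_feasible y /\ forall y', dual_feasible y' -> dot b y' <= dot b y.

Definition active_set (y : 'cV[R]_m) : {set 'I_n} :=
  [set j | dot (col j A) y == c j 0].

Definition nondegenerate (y : 'cV[R]_m) : Prop := #|active_set y| = m.

(* A set of m column indices is represented by an injective enumeration
   f : 'I_m -> 'I_n of it; the associated basic solutions do not depend on the
   order of enumeration. *)
Definition basis_mx (f : 'I_m -> 'I_n) : 'M[R]_m := colsub f A.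

Definition basic_solution (f : 'I_m -> 'I_n) : 'cV[R]_n :=
  \col_j \sum_(i | f i == j) (invmx (basis_mx f) *m b) i 0.

Definition basic_dual_solution (f : 'I_m -> 'I_n) : 'cV[R]_m :=
  (invmx (basis_mx f))^T *m rowsub f c.

Definition optimal_basis (f : 'I_m -> 'I_n) : Prop :=
  [/\ injective f, basis_mx f \in unitmx,
      primal_optimal (basic_solution f) & dual_optimal (basic_dual_solution f)].

Definition slack (y : 'cV[R]_m) (j : 'I_n) : R :=
  (c j 0 - dot (col j A) y) / norm2 (col j A).

End LinearProgram.

(* f enumerates m indices carrying the m smallest values of z (several choices
   are possible when there are ties). *)
Definition selects_smallest (R : realType) (m n : nat) (z : 'I_n -> R)
    (f : 'I_m -> 'I_n) : Prop :=
  injective f /\ forall i j, j \notin codom f -> z (f i) <= z j.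

Section Retrieval.
Context {R : realType} {m n k : nat}.
Variables (A : 'M[R]_(m, n)) (b : 'cV[R]_m) (c : 'cV[R]_n) (T : 'M[R]_(k, m)).

Definition projected_optimal_basis (h : 'I_k -> 'I_n) : Prop :=
  optimal_basis (T *m A) (T *m b) c h.

Definition prox_dual (h : 'I_k -> 'I_n) : 'cV[R]_m :=
  T^T *m basic_dual_solution (T *m A) c h.

(* P_T has an optimal basis and, whichever of them is given and however ties
   are broken, the returned x = A_B^{-1} b is a basic solution of P with respect
   to an optimal basis B. *)
Definition retrieval_succeeds : Prop :=
  (exists h, projected_optimal_basis h) /\
  forall (h : 'I_k -> 'I_n) (f : 'I_m -> 'I_n), projected_optimal_basis h ->
    selects_smallest (slack A c (prox_dual h)) f ->
    optimal_basis A b c f.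

Definition prox_within (ystar : 'cV[R]_m) (r : R) : Prop :=
  (exists h, projected_optimal_basis h) /\
  forall h, projected_optimal_basis h -> norm2 (ystar - prox_dual h) <= r.

End Retrieval.

Section Probability.
Context {R : realType} {d : measure_display} {Omega : measurableType d}.
Variable P : probability Omega R.

(* For a measurable event E this is p%:E <= P E; the formulation spares a
   separate measurability hypothesis. *)
Definition with_probability_at_least (p : R) (E : set Omega) : Prop :=
  exists F, [/\ measurable F, F `<=` E & (p%:E <= P F)%E].

Definition mutually_independent (I : finType) (X : I -> {RV P >-> R}) : Prop :=
  forall B : I -> set R, (forall i, measurable (B i)) ->
    P [set w | forall i, B i (X i w)] = (\prod_i P (X i @^-1` B i))%E.

Section Projectors.
Context {k m : nat}.
Implicit Type U : 'I_k * 'I_m -> {RV P >-> R}.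

Definition random_mx U (w : Omega) : 'M[R]_(k, m) := \matrix_(i, j) U (i, j) w.

Definition is_standard_normal (X : {RV P >-> R}) : Prop :=
  forall B : set R, measurable B -> P (X @^-1` B) = normal_prob 0 1 B.

Definition is_sign (X : {RV P >-> R}) : Prop :=
  P (X @^-1` [set 1]) = (2^-1)%:E /\ P (X @^-1` [set -1]) = (2^-1)%:E.

Definition is_sparse_sign (X : {RV P >-> R}) : Prop :=
  [/\ P (X @^-1` [set 1]) = (6^-1)%:E, P (X @^-1` [set 0]) = (2 / 3)%:E
    & P (X @^-1` [set -1]) = (6^-1)%:E].

(* The rows of Q are an orthonormal basis of a random k-dimensional subspace V.
   V is uniformly distributed: the law of the orthogonal projection Q^T Q onto
   V is that of the projection O Q^T Q O^T onto the rotated subspace, for every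
   orthogonal O (the two laws being compared on the rectangles, which generate
   the Borel sets of matrices). The choice of the basis of V is free. *)
Definition orthonormal_basis_of_random_subspace U : Prop :=
  (forall w, random_mx U w *m (random_mx U w)^T = 1%:M) /\
  let proj w := (random_mx U w)^T *m random_mx U w in
  forall (O : 'M[R]_m) (B : 'I_m -> 'I_m -> set R), O *m O^T = 1%:M ->
    (forall i j, measurable (B i j)) ->
    P [set w | forall i j, B i j ((O *m proj w *m O^T) i j)] =
    P [set w | forall i j, B i j (proj w i j)].

Variant random_projector (T : Omega -> 'M[R]_(k, m)) : Prop :=
| ProjSubspace U of orthonormal_basis_of_random_subspace U
    & (forall w, T w = Num.sqrt (m%:R / k%:R) *: random_mx U w)
| ProjGaussian U of mutually_independent U
    & (forall ij, is_standard_normal (U ij))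
    & (forall w, T w = (Num.sqrt k%:R)^-1 *: random_mx U w)
| ProjSign U of mutually_independent U
    & (forall ij, is_sign (U ij))
    & (forall w, T w = (Num.sqrt k%:R)^-1 *: random_mx U w)
| ProjSparse U of mutually_independent U
    & (forall ij, is_sparse_sign (U ij))
    & (forall w, T w = Num.sqrt (3 / k%:R) *: random_mx U w).

End Projectors.

Definition prox_radius (m : nat) (b ystar : 'cV[R]_m) (theta alpha C eps : R) : R :=
  C * theta ^+ 2 * eps / (cos alpha * norm2 b) * norm2 ystar.

Definition confidence (n k : nat) (C eps : R) : R :=
  1 - 4 * n%:R * expR (- (C * (eps ^+ 2 - eps ^+ 3) * k%:R)).

(* C is a constant for which y_prox satisfies its error estimate, with the same
   C in the radius and in the probability. The estimate is only required for the
   data at hand; a universal constant satisfies it for all data. *)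
Definition prox_constant (m n k : nat) (A : 'M[R]_(m, n)) (b : 'cV[R]_m)
    (c : 'cV[R]_n) (theta : R) (ystar : 'cV[R]_m) (alpha : R)
    (T : Omega -> 'M[R]_(k, m)) (eps C : R) : Prop :=
  with_probability_at_least (confidence n k C eps)
    [set w | prox_within A b c (T w) ystar
               (prox_radius b ystar theta alpha C eps)].

End Probability.

(* Main.v *)
(* A dual optimal vertex whose active columns form a nonsingular square matrix
   determines an optimal basis: primal feasibility holds because a negative
   basic coordinate would give an ascent direction, and optimality follows by
   weak duality.  If y_prox is within r < d*/2 of y*, Cauchy-Schwarz moves each
   reduced cost by at most r, so the active columns have z_j < d*/2 and the others
   z_j > d*/2: the m smallest z_j single out exactly the active set. *)
Require Import Defs.
From mathcomp Require Import ring lra.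
Set Implicit Arguments.
Unset Strict Implicit.
Unset Printing Implicit Defensive.
Import Order.TTheory GRing.Theory Num.Theory.
Local Open Scope classical_set_scope.
Local Open Scope ring_scope.


Section Dot.
Context {R : realType} {m : nat}.
Implicit Types u v w : 'cV[R]_m.

Lemma dotE u v : dot u v = (u^T *m v) 0 0.
Proof. by rewrite mxE; apply: eq_bigr => i _; rewrite mxE. Qed.

Lemma dotC u v : dot u v = dot v u.
Proof. by apply: eq_bigr => i _; rewrite mulrC. Qed.

Lemma dotDr u v w : dot u (v + w) = dot u v + dot u w.
Proof. by rewrite !dotE mulmxDr mxE. Qed.

Lemma dotZr u a v : dot u (a *: v) = a * dot u v.
Proof. by rewrite !dotE -scalemxAr mxE. Qed.

Lemma dotNr u v : dot u (- v) = - dot u v.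
Proof. by rewrite !dotE mulmxN mxE. Qed.

Lemma dotBr u v w : dot u (v - w) = dot u v - dot u w.
Proof. by rewrite dotDr dotNr. Qed.

Lemma dot_ge0 u : 0 <= dot u u.
Proof. by apply: sumr_ge0 => i _; rewrite -expr2 sqr_ge0. Qed.

(** Cauchy-Schwarz for a unit [u]: the squared length of [v - dot u v *: u] is
    [dot v v - (dot u v)^2]. *)
Lemma norm_dot_le_unit u v : norm2 u = 1 -> `|dot u v| <= norm2 v.
Proof.
move=> u1; have uu1 : dot u u = 1 by rewrite -(sqr_sqrtr (dot_ge0 u)) -/(norm2 u) u1 expr1n.
rewrite -sqrtr_sqr ler_wsqrtr //.
have := dot_ge0 (v - dot u v *: u).
rewrite dotBr dotZr ![dot (v - _) _]dotC !dotBr !dotZr uu1 (dotC v u) mulr1 subrr.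
by rewrite mulr0 subr0 subr_ge0 expr2.
Qed.

End Dot.

Section DualPolyhedron.
Context {R : realType} {m n : nat}.
Variables (A : 'M[R]_(m, n)) (b : 'cV[R]_m) (c : 'cV[R]_n).

Lemma uniform_step (a s : 'I_n -> R) :
  exists2 t : R, 0 < t & forall j, 0 < s j -> t * a j <= s j.
Proof.
(* [M] dominates every ratio [a j / s j] at once; the summand 1 keeps it positive when no [s j]
   is. *)
pose M : R := 1 + \sum_(j | 0 < s j) `|a j| / s j.
have M0 : 0 < M.
  by rewrite ltr_pwDl // sumr_ge0 // => j /ltW sj; rewrite divr_ge0.
exists M^-1; first by rewrite invr_gt0.
move=> j sj; rewrite ler_pdivrMl // -ler_pdivrMr //.
apply: (@le_trans _ _ (`|a j| / s j)).
  by rewrite ler_wpM2r ?ler_norm // invr_ge0 ltW.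
rewrite /M (bigD1 j) //= addrCA lerDl addr_ge0 // sumr_ge0 // => i /andP[/ltW si _].
by rewrite divr_ge0.
Qed.

(** Active constraints do not increase along [v]; inactive ones have positive slack, which a small
    enough common step does not exhaust. *)
Lemma dual_feasible_step (y v : 'cV[R]_m) : dual_feasible A c y ->
  (forall j, j \in active_set A c y -> dot (col j A) v <= 0) ->
  exists2 t : R, 0 < t & dual_feasible A c (y + t *: v).
Proof.
move=> Fy Hv.
have [t t0 Ht] := uniform_step (fun j => dot (col j A) v)
  (fun j => c j 0 - dot (col j A) y).
exists t => // j; rewrite dotDr dotZr.
have [aj|] := boolP (j \in active_set A c y).
  move: (Hv _ aj); rewrite inE in aj; rewrite (eqP aj) => vj.
  by rewrite gerDl mulr_ge0_le0 // ltW.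
rewrite inE => naj; rewrite addrC -lerBrDr; apply: Ht.
by rewrite subr_gt0 lt_neqAle naj Fy.
Qed.

(** The active columns span the space: a [v] orthogonal to all of them allows feasible moves both
    ways, which extremality forbids unless [v = 0]. *)
Lemma vertex_active_orthogonal (y v : 'cV[R]_m) : vertex (dual_feasible A c) y ->
  (forall j, j \in active_set A c y -> dot (col j A) v = 0) -> v = 0.
Proof.
move=> [sub ext] Hv; have Fy : dual_feasible A c y by apply: sub.
have [t t0 Ft] : exists2 t : R, 0 < t & dual_feasible A c (y + t *: v).
  by apply: dual_feasible_step => // j /Hv ->.
have [s s0 Fs] : exists2 s : R, 0 < s & dual_feasible A c (y + s *: (- v)).
  by apply: dual_feasible_step => // j /Hv vj; rewrite dotNr vj oppr0.
have ts0 : 0 < t + s by rewrite addr_gt0.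
(* With this weight, [y + t *: v] and [y - s *: v] combine to [y]. *)
have l01 : 0 < s / (t + s) < 1.
  by rewrite divr_gt0 //= ltr_pdivrMr // mul1r ltrDr.
have /= [|/eqP ] := ext _ _ _ Ft Fs l01.
  apply/colP => i; rewrite !mxE; field; exact: lt0r_neq0.
by rewrite -subr_eq0 addrAC subrr add0r scaler_eq0 gt_eqF //= => /eqP.
Qed.

Section Basis.
Variables (y : 'cV[R]_m) (f : 'I_m -> 'I_n).
Hypothesis vertex_y : vertex (dual_feasible A c) y.
Hypothesis active_f : forall j, (j \in codom f) = (j \in active_set A c y).

Lemma tr_basis_mx_mul (v : 'cV[R]_m) i :
  ((basis_mx A f)^T *m v) i 0 = dot (col (f i) A) v.
Proof. by rewrite mxE; apply: eq_bigr => k _; rewrite !mxE. Qed.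

(** A left kernel row of the square basis matrix, transposed, is orthogonal to all active columns,
    hence zero. *)
Lemma basis_mx_unit : basis_mx A f \in unitmx.
Proof.
rewrite -row_free_unit -kermx_eq0; apply/eqP/row_matrixP => i; rewrite row0.
rewrite -[LHS]trmxK; apply/(canLR (@trmxK _ _ _)); rewrite trmx0.
apply: (vertex_active_orthogonal vertex_y) => j; rewrite -active_f => /codomP[l ->].
by rewrite -tr_basis_mx_mul -trmx_mul -row_mul mulmx_ker row0 trmx0 mxE.
Qed.

Lemma basic_dual_solution_active : basic_dual_solution A c f = y.
Proof.
have cf : rowsub f c = (basis_mx A f)^T *m y.
  apply/colP => i; rewrite tr_basis_mx_mul mxE; apply/esym/eqP.
  by have := codom_f f i; rewrite active_f inE.
by rewrite /basic_dual_solution cf trmx_inv mulKmx ?unitmx_tr ?basis_mx_unit.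
Qed.

Lemma basic_coordinate_ge0 i : dual_optimal A b c y ->
  0 <= (invmx (basis_mx A f) *m b) i 0.
Proof.
move=> [Fy opt_y]; set B := basis_mx A f; have uB : B \in unitmx := basis_mx_unit.
(* This direction relaxes the [i]-th basic constraint and keeps the others tight, while the dual
   objective changes at rate minus the [i]-th basic coordinate. *)
pose v : 'cV[R]_m := (invmx B)^T *m (- delta_mx i 0).
have Bv : B^T *m v = - delta_mx i 0 by rewrite /v trmx_inv mulKVmx ?unitmx_tr.
have bv : dot b v = - (invmx B *m b) i 0.
  rewrite dotE -{1}(mulKVmx uB b) trmx_mul -mulmxA Bv mulmxN -colE.
  by rewrite !mxE.
have [t t0 Ft] : exists2 t : R, 0 < t & dual_feasible A c (y + t *: v).
  apply: dual_feasible_step => // j; rewrite -active_f => /codomP[l ->].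
  by rewrite -tr_basis_mx_mul Bv !mxE oppr_le0 ler0n.
have := opt_y _ Ft.
by rewrite dotDr dotZr gerDl pmulr_rle0 // bv oppr_le0.
Qed.

(** Used with [F] a row of [A] for feasibility and with [F] the cost vector for the objective. *)
Lemma sum_basic_solution (F : 'I_n -> R) :
  \sum_j F j * basic_solution A b f j 0 =
  \sum_i F (f i) * (invmx (basis_mx A f) *m b) i 0.
Proof.
under eq_bigr => j _ do rewrite mxE mulr_sumr.
rewrite (exchange_big_dep xpredT) //=; apply: eq_bigr => i _.
by rewrite (big_pred1 (f i)) // => j; rewrite eq_sym.
Qed.

Lemma active_basis_optimal : injective f -> dual_optimal A b c y ->
  optimal_basis A b c f.
Proof.
move=> f_inj opt_y; split => //; first exact: basis_mx_unit.
  2: by rewrite basic_dual_solution_active.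
have Ax : A *m basic_solution A b f = b.
  apply/colP => l; rewrite mxE (sum_basic_solution (A l)).
  rewrite -[b in RHS](mulKVmx basis_mx_unit) mxE.
  by apply: eq_bigr => i _; rewrite !mxE.
(* Serves twice: for the basic solution (complementary slackness) and for any competitor (weak
   duality). *)
have dot_primal x : A *m x = b -> dot b y = \sum_j dot (col j A) y * x j 0.
  move=> <-; rewrite dotC dotE mulmxA mxE; apply: eq_bigr => j _.
  by rewrite mxE; congr (_ * _); apply: eq_bigr => i _; rewrite !mxE mulrC.
have cx : dot c (basic_solution A b f) = dot b y.
  rewrite (dot_primal _ Ax) [LHS]/dot !sum_basic_solution; apply: eq_bigr => i _.
  by have := codom_f f i; rewrite active_f inE => /eqP ->.
split; first split => // j.
  by rewrite mxE sumr_ge0 // => i _; exact: basic_coordinate_ge0.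
move=> x [/dot_primal bx x0]; rewrite cx bx; apply: ler_sum => j _.
by rewrite ler_wpM2r //; case: opt_y => + _; apply.
Qed.

End Basis.

Lemma slack_dist (y y' : 'cV[R]_m) j : norm2 (col j A) = 1 ->
  `|slack A c y j - slack A c y' j| <= norm2 (y - y').
Proof.
move=> Aj1; rewrite /slack Aj1 !divr1 opprB addrC addrA subrK -dotBr -normrN -dotNr opprB.
exact: norm_dot_le_unit.
Qed.

(** Both sets have [m] elements, so one inclusion suffices. If it failed, an inactive index would be
    selected and an active one left out, against the order of their slacks at [y']. *)
Lemma selects_active (y y' : 'cV[R]_m) (ds : R) (f : 'I_m -> 'I_n) :
  (forall j, norm2 (col j A) = 1) -> nondegenerate A c y ->
  (forall j, j \notin active_set A c y -> ds <= slack A c y j) ->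
  norm2 (y - y') < ds / 2 -> selects_smallest (slack A c y') f ->
  forall j, (j \in codom f) = (j \in active_set A c y).
Proof.
move=> A1 nd dsP yy' [f_inj f_min].
have cardf : #|codom f| = #|active_set A c y| by rewrite card_codom // card_ord nd.
suff sub : codom f \subset active_set A c y.
  by apply/subset_cardP.
apply: contraT => nsub.
have /fintype.subsetPn[j aj nj] : ~~ (active_set A c y \subset codom f).
  apply: contra nsub => /(subset_cardP (esym cardf)) eq_act.
  by apply/fintype.subsetP => i; rewrite eq_act.
move/fintype.subsetPn: nsub => [_ /codomP[i ->] /dsP zi].
have := f_min i j nj.
have sj : slack A c y j = 0.
  by move: aj; rewrite inE /slack => /eqP ->; rewrite subrr mul0r.
move: (slack_dist y y' (A1 j)) (slack_dist y y' (A1 (f i))).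
rewrite sj !ler_norml => /andP[? ?] /andP[? ?] ?; lra.
Qed.

End DualPolyhedron.

Theorem proposition5p3 (R : realType) (m n k : nat)
    (A : 'M[R]_(m, n)) (b : 'cV[R]_m) (c : 'cV[R]_n) (theta : R)
    (norm_b : norm2 b = 1) (norm_c : norm2 c = 1)
    (norm_A : forall j, norm2 (col j A) = 1)
    (primal_nonempty : primal_feasible A b !=set0)
    (primal_bounded : bounded_set (primal_feasible A b))
    (theta_ge1 : 1 <= theta)
    (theta_bound : exists2 xstar : 'cV[R]_n,
       primal_optimal A b c xstar & \sum_j xstar j 0 < theta)
    (no_degenerate_vertex : forall y, vertex (dual_feasible A c) y ->
       nondegenerate A c y)
    (b_in_normal_cone : exists2 ybar, vertex (dual_feasible A c) ybar &
       relative_interior (normal_cone (dual_feasible A c) ybar) b)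
    (ystar : 'cV[R]_m) (ystar_optimal : dual_optimal A b c ystar)
    (dstar : R)
    (dstar_min : is_minimum
       [set slack A c ystar j | j in [set j | j \notin active_set A c ystar]]
       dstar)
    (tangent_cone_generated :
       tangent_cone (dual_feasible A c) ystar =
       conic_hull (edge_directions (dual_feasible A c) ystar))
    (edges_descend : forall v,
       edge_directions (dual_feasible A c) ystar v -> dot b v < 0)
    (alpha : R)
    (alpha_angle : [set angle (- b) v |
       v in edge_directions (dual_feasible A c) ystar] alpha)
    (alpha_min : is_minimum
       [set cos (angle (- b) v) |
          v in edge_directions (dual_feasible A c) ystar] (cos alpha))
    (d : measure_display) (Omega : measurableType d) (P : probability Omega R)
    (T : Omega -> 'M[R]_(k, m)) (T_projector : random_projector P T)
    (eps C : R) (eps_gt0 : 0 < eps)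
    (C_constant : prox_constant P A b c theta ystar alpha T eps C)
    (eps_small : prox_radius b ystar theta alpha C eps < dstar / 2) :
  with_probability_at_least P (confidence n k C eps)
    [set w | retrieval_succeeds A b c (T w)].
Proof.
(* The angle [alpha] comes from an edge at [ystar], whose endpoints are vertices. *)
have vy : vertex (dual_feasible A c) ystar by case: alpha_angle => ? [? [? []]].
(* The rest is deterministic: on the event where the estimate for the prox dual holds, retrieval
   succeeds, so the probability bound carries over. *)
case: C_constant => F [mF FE pF]; exists F; split => // w /FE [hex near]; split => //.
move=> h f hopt fsel.
apply: (active_basis_optimal vy) => //; last by case: fsel.
apply: (selects_active norm_A (no_degenerate_vertex _ vy)) fsel.
  by move=> j nj; apply: dstar_min.2; exists j.
exact: le_lt_trans (near h hopt) eps_small.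
Qed.
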